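(* Let $(X,d)$ be a $K$-quasi-metric space, let $X_\infty$ denote its infinitely remote set and let $\infty\in X_\infty$. Let $\lambda:X\to[0,\infty]$, $L>0$ and $K'\ge K$ be such that $X_\infty=\lambda^{-1}(\infty)$ and, for all $x,y\in X$ for which $d(x,y)$ is defined, $$d(x,y)\le K'\max\{L\lambda(x),L\lambda(y)\},\qquad L\lambda(x)\le K'\max\{d(x,y),L\lambda(y)\}.$$ Put $X'_\infty:=\lambda^{-1}(0)$ and define $d_\lambda:(X\times X)\setminus(X'_\infty\times X'_\infty)\to[0,\infty]$ by (1) $d_\lambda(x,y):=\frac{d(x,y)}{\lambda(x)\lambda(y)}$ for $x,y\in X\setminus X'_\infty$ (pairs involving $\infty\in X_\infty$ being treated by (2) and (3)); (2) $d_\lambda(x,\infty):=d_\lambda(\infty,x):=\frac{L}{\lambda(x)}$ for $\infty\in X_\infty$; (3) $d_\lambda(\infty,\infty):=0$ for $\infty\in X_\infty$; (4) $d_\lambda(x,p):=d_\lambda(p,x):=\infty$ for $p\in X'_\infty$. Let $\theta\le\frac{1}{K^{19}}$. If $(X,d_\lambda)$ has a $\theta$-chain, then $(X,d)$ has a $\sqrt[3]{\theta K'^4}$-chain.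
   Context: A \emph{$K$-quasi-metric space} $(X,d)$ with infinitely remote set $X_\infty\subset X$ is a set $X$ with a function $d$ with values in $[0,\infty]$, defined on $(X\times X)\setminus(X_\infty\times X_\infty)$, satisfying, whenever the distances involved are defined: (1) $d(x,y)=0\iff x=y$; (2) $d(x,y)=d(y,x)$; (3) $d(x,y)\le K\max\{d(x,z),d(z,y)\}$ for all $x,y,z\in X$ for which all distances are defined; (4) $d(x,y)<\infty\iff x,y\in X\setminus X_\infty$. For $\theta<1$, a \emph{$\theta$-chain} in a space $(Z,\rho)$ is a sequence $(z_0,z_1,\ldots,z_n)$ of (at least $3$ distinct) points of $Z$, not infinitely remote for $\rho$, such that $\rho(z_i,z_{i+1})\le\theta\,\rho(z_0,z_n)$ for all $i\in\{0,1,\ldots,n-1\}$. For $d$ the infinitely remote points are those of $X_\infty$; for $d_\lambda$ they are those of $X'_\infty$.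
   Formalization: The formal theorem assumes that ∞ is the only point of X_∞ (otherwise distinct remote points get d_λ-distance 0 and the claim fails), and that the parameter ∛(θK'^4) is less than 1, as the definition of a chain requires. *)

(* Defs.v *)
From mathcomp Require Import all_boot all_order all_algebra.
From mathcomp Require Import all_classical all_reals.

Set Implicit Arguments.
Unset Strict Implicit.
Unset Printing Implicit Defensive.

Import Order.TTheory GRing.Theory Num.Theory.

Local Open Scope classical_set_scope.
Local Open Scope ring_scope.
Local Open Scope ereal_scope.

(* A distance on (X * X) \ (Xinf * Xinf) is encoded as a total function        *)
(* d : X -> X -> \bar R whose values on Xinf * Xinf are irrelevant: every use  *)
(* of d x y below is guarded by [dist_dom Xinf x y].                           *)
Definition dist_dom (X : Type) (Xinf : set X) (x y : X) : Prop :=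
  ~ (Xinf x /\ Xinf y).

Record quasi_metric (R : realType) (X : Type) (K : R) (Xinf : set X)
    (d : X -> X -> \bar R) : Prop := QuasiMetric {
  qm_ge0 : forall x y, dist_dom Xinf x y -> 0 <= d x y;
  qm_eq0 : forall x y, dist_dom Xinf x y -> (d x y = 0 <-> x = y);
  qm_sym : forall x y, dist_dom Xinf x y -> d x y = d y x;
  qm_triangle : forall x y z,
    dist_dom Xinf x y -> dist_dom Xinf x z -> dist_dom Xinf z y ->
    d x y <= K%:E * maxe (d x z) (d z y);
  qm_fin : forall x y, dist_dom Xinf x y ->
    (d x y < +oo <-> ~ Xinf x /\ ~ Xinf y) }.

(* The distance d_lambda, to be read on pairs not both in [lambda = 0].        *)
(* In the last three clauses no inverse is taken at 0, since points of           *)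
(* [lambda = 0] are treated by the first clause.                               *)
Definition dlambda (R : realType) (X : Type) (Xinf : set X)
    (d : X -> X -> \bar R) (lambda : X -> \bar R) (L : R) (x y : X) : \bar R :=
  if (lambda x == 0) || (lambda y == 0) then +oo
  else if (x \in Xinf) && (y \in Xinf) then 0
  else if y \in Xinf then L%:E / lambda x
  else if x \in Xinf then L%:E / lambda y
  else d x y / (lambda x * lambda y).

(* [has_chain Zinf rho theta]: there is a theta-chain z 0, ..., z n in the     *)
(* space (Z, rho) with infinitely remote set Zinf. Repetitions are allowed,    *)
(* but at least three of the points are pairwise distinct. The restriction     *)
(* theta < 1 is not part of the definition and has to be assumed where it is   *)
(* used.                                                                       *)
Definition has_chain (R : realType) (Z : Type) (Zinf : set Z)
    (rho : Z -> Z -> \bar R) (theta : R) : Prop :=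
  exists (n : nat) (z : nat -> Z),
    [/\ forall i, (i <= n)%N -> ~ Zinf (z i),
        exists i j k, [/\ (i <= n)%N, (j <= n)%N & (k <= n)%N] /\
                      [/\ z i <> z j, z i <> z k & z j <> z k]
      & forall i, (i < n)%N -> rho (z i) (z i.+1) <= theta%:E * rho (z 0%N) (z n)].

(* Main.v *)
(* Write l = L * lambda, M = K', D = d (z 0) (z n) and e ^ 3 = theta * M ^ 4.
   Suppose that d has no e-chain; then any chain with steps at most e * b has
   endpoints at distance at most b. Reversing the chain z of d_lambda, assume
   l (z 0) <= l (z n), so that theta * d_lambda (z 0) (z n) is at most
   theta * M * L / lambda (z 0). By induction along z, the points stay within
   l (z 0) of z 0, hence l (z i) <= M * l (z 0): this keeps the chain off the
   infinitely remote point and bounds its next step by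
   theta * M ^ 4 * l (z 0) = e ^ 3 * l (z 0). With these bounds on l, the steps
   of z are at most theta * M ^ 2 * D <= e ^ 3 * D, so z itself is an e-chain. *)

Require Import Defs.
From mathcomp Require Import all_boot all_order all_algebra.
From mathcomp Require Import all_classical all_reals.
From mathcomp Require Import exp.
From mathcomp Require Import ring lra.

Set Implicit Arguments.
Unset Strict Implicit.
Unset Printing Implicit Defensive.

Import Order.TTheory GRing.Theory Num.Theory.

Local Open Scope classical_set_scope.
Local Open Scope ring_scope.

(** * Finite distances, and spaces without chains *)

Lemma quasi_metric_fineK (R : realType) (X : Type) (K : R) (Xinf : set X)
    (d : X -> X -> \bar R) (hd : quasi_metric K Xinf d) (x y : X) :
  ~ Xinf x -> ~ Xinf y -> ((fine (d x y))%:E = d x y)%E.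
Proof.
move=> hx hy; have hxy : dist_dom Xinf x y by case.
apply/fineK; rewrite ge0_fin_numE; last exact: qm_ge0 hd _ _ hxy.
exact/(qm_fin hd hxy).
Qed.

Lemma quasi_metric_fine_ge0 (R : realType) (X : Type) (K : R) (Xinf : set X)
    (d : X -> X -> \bar R) (hd : quasi_metric K Xinf d) (x y : X) :
  ~ Xinf x -> 0 <= fine (d x y).
Proof. by move=> hx; apply/fine_ge0/(qm_ge0 hd) => -[]. Qed.

Lemma quasi_metric_fine_gt0 (R : realType) (X : Type) (K : R) (Xinf : set X)
    (d : X -> X -> \bar R) (hd : quasi_metric K Xinf d) (x y : X) :
  ~ Xinf x -> ~ Xinf y -> x <> y -> 0 < fine (d x y).
Proof.
move=> hx hy xy; rewrite lt_neqAle (quasi_metric_fine_ge0 hd) // andbT eq_sym.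
apply/eqP => h0; apply: xy; apply/(qm_eq0 hd); first by case.
by rewrite -(quasi_metric_fineK hd) // h0.
Qed.

(** Taking [x] itself as the intermediate point, the triangle inequality reads [d x y <= K * d x y]
    with [0 < d x y < +oo]. *)
Lemma quasi_metric_ge1 (R : realType) (X : Type) (K : R) (Xinf : set X)
    (d : X -> X -> \bar R) (hd : quasi_metric K Xinf d) (x y : X) :
  ~ Xinf x -> ~ Xinf y -> x <> y -> 1 <= K.
Proof.
move=> hx hy xy; have dxy := quasi_metric_fine_gt0 hd hx hy xy.
have Dxx : dist_dom Xinf x x by case.
have Dxy : dist_dom Xinf x y by case.
have := qm_triangle hd Dxy Dxx Dxy.
rewrite (qm_eq0 hd Dxx).2 // max_r; last exact: qm_ge0 hd _ _ Dxy.
by rewrite -(quasi_metric_fineK hd) // -EFinM lee_fin ler_pMl.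
Qed.

(* If at most two values occur, some step joins the two distinct endpoints,
   which is impossible as the parameter is smaller than 1. *)
Lemma has_chain_of_steps (R : realType) (X : Type) (K : R) (Xinf : set X)
    (d : X -> X -> \bar R) (hd : quasi_metric K Xinf d) (e : R) (n : nat)
    (w : nat -> X) :
  e < 1 -> (forall i, (i <= n)%N -> ~ Xinf (w i)) -> w 0%N <> w n ->
  (forall i, (i < n)%N ->
     fine (d (w i) (w i.+1)) <= e * fine (d (w 0%N) (w n))) ->
  has_chain Xinf d e.
Proof.
move=> e1 hw w0n hs; exists n, w; split=> //; last first.
  move=> i lin; rewrite -(quasi_metric_fineK hd (hw 0%N (leq0n n)) (hw n (leqnn n))).
  rewrite -(quasi_metric_fineK hd (hw i (ltnW lin)) (hw i.+1 lin)).
  by rewrite -EFinM lee_fin; exact: hs.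
apply: contrapT => h3.
have two i : (i <= n)%N -> w i = w 0%N \/ w i = w n.
  move=> lin; case: (pselect (w i = w 0%N)) => [|hi0]; first by left.
  case: (pselect (w i = w n)) => [|hin]; first by right.
  by case: h3; exists 0%N, i, n; split; split => // /esym.
apply: (w0n); apply/esym.
suff h i : (i <= n)%N -> w i = w 0%N by exact: h.
elim: i => // i IH lin.
have {}IH := IH (ltnW lin).
case: (two _ lin) => // hin; exfalso.
have := hs _ lin; rewrite IH hin leNgt gtr_pMl ?e1 //.
by apply: (quasi_metric_fine_gt0 hd); [exact: hw | exact: hw |].
Qed.

(* Up to the factor [1 / e], a space without [e]-chains is ultrametric. *)
Lemma no_chain_bound (R : realType) (X : Type) (K : R) (Xinf : set X)
    (d : X -> X -> \bar R) (hd : quasi_metric K Xinf d) (e : R) :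
  0 < e < 1 -> ~ has_chain Xinf d e ->
  forall (n : nat) (w : nat -> X) (b : R), 0 <= b ->
  (forall i, (i <= n)%N -> ~ Xinf (w i)) ->
  (forall i, (i < n)%N -> fine (d (w i) (w i.+1)) <= e * b) ->
  fine (d (w 0%N) (w n)) <= b.
Proof.
move=> /andP[e0 e1] hno n w b b0 hw hs; rewrite leNgt; apply/negP => hb.
apply: hno; apply: (has_chain_of_steps hd e1 hw).
  move=> w0n; have Dww : dist_dom Xinf (w n) (w n) by case=> /(hw n (leqnn n)).
  by move: hb; rewrite w0n (qm_eq0 hd Dww).2 //= ltNge b0.
move=> i lin; apply: le_trans (hs i lin) _.
by rewrite ler_pM2l // ltW.
Qed.

(** * Control of [lambda] along a chain of the inverted space *)

(** Here [P] stands for [d_lambda (z 0) (z n)]. It is kept abstract because [z n] may still be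
    infinitely remote at this stage; the bound on [P * lam (z 0)] holds in either case. *)
Lemma inversion_chain_bounds (R : realType) (X : Type) (Xinf : set X)
    (D : X -> X -> R) (lam : X -> R) (L M t e P : R) (n : nat) (z : nat -> X) :
  0 < L -> 1 <= M -> 0 < t -> 0 < e < 1 -> e ^+ 3 = t * M ^+ 4 ->
  (forall (m : nat) (w : nat -> X) (b : R), 0 <= b ->
    (forall i, (i <= m)%N -> ~ Xinf (w i)) ->
    (forall i, (i < m)%N -> D (w i) (w i.+1) <= e * b) -> D (w 0%N) (w m) <= b) ->
  (forall x y, ~ Xinf x -> ~ Xinf y -> D x y = D y x) ->
  (forall i, (i <= n)%N -> ~ Xinf (z i) -> 0 < lam (z i)) ->
  (forall x y, ~ Xinf x -> ~ Xinf y ->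
    L * lam x <= M * Num.max (D x y) (L * lam y)) ->
  ~ Xinf (z 0%N) -> P * lam (z 0%N) <= M * L ->
  (forall i, (i < n)%N -> ~ Xinf (z i) -> Xinf (z i.+1) -> L / lam (z i) <= t * P) ->
  (forall i, (i < n)%N -> ~ Xinf (z i) -> ~ Xinf (z i.+1) ->
    D (z i) (z i.+1) / (lam (z i) * lam (z i.+1)) <= t * P) ->
  forall i, (i <= n)%N -> ~ Xinf (z i) /\ lam (z i) <= M * lam (z 0%N).
Proof.
move=> L0 M1 t0 /andP[e0 e1] he hch Dsym lam0 hlam z0 hP hinf hfin.
have M0 : 0 < M by exact: lt_le_trans M1.
have l0 : 0 < lam (z 0%N) by exact: lam0.
have e31 : e ^+ 3 < 1 by rewrite exprn_ilt1 // ltW.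
(* [tM2] will exclude a step into [Xinf], and [tM3] will decide which term of a maximum
   dominates. *)
have tM2 : t * M ^+ 2 < 1.
  by apply: le_lt_trans e31; rewrite he ler_pM2l // ler_weXn2l.
have tM3 : t * M ^+ 3 < 1.
  by apply: le_lt_trans e31; rewrite he ler_pM2l // ler_weXn2l.
(* The induction carries the bounds on all earlier steps, since [hch] is applied to the whole
   initial segment, with [b = L * lam (z 0)]. *)
suff H : forall i, (i <= n)%N -> (forall j, (j <= i)%N -> ~ Xinf (z j)) /\
    (forall j, (j < i)%N -> D (z j) (z j.+1) <= e * (L * lam (z 0%N))) /\
    lam (z i) <= M * lam (z 0%N).
  by move=> i /H[hz [_ hl]]; split=> //; exact: hz.
have bound i : (forall j, (j <= i)%N -> ~ Xinf (z j)) ->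
    (forall j, (j < i)%N -> D (z j) (z j.+1) <= e * (L * lam (z 0%N))) ->
    lam (z i) <= M * lam (z 0%N).
  move=> hz hs; have Di : D (z 0%N) (z i) <= L * lam (z 0%N).
    by apply: hch hs => //; rewrite mulr_ge0 // ltW.
  rewrite -(ler_pM2l L0) mulrCA.
  apply: le_trans (hlam _ _ (hz i (leqnn i)) z0) _.
  by rewrite ler_pM2l // ge_max lexx andbT Dsym //; exact: hz.
elim=> [_|i IH lin].
  split; [by case | split=> //; by rewrite ler_peMl // ltW].
have [hz [hs hl]] := IH (ltnW lin).
have zi := hz i (leqnn i).
have li0 : 0 < lam (z i) by apply: lam0 => //; exact: ltnW.
(* One factor [M] comes from [hl], the other from [hP]. The sign of [P] is not among the hypotheses,
   hence the case distinction. *)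
have tP : t * P * lam (z i) <= t * M ^+ 2 * L.
  have -> : t * M ^+ 2 * L = t * (M * (M * L)) by ring.
  rewrite -mulrA ler_pM2l //; case: (leP P 0) => [P0|P0].
    apply: (@le_trans _ _ 0); last by rewrite !mulr_ge0 // ltW.
    by rewrite mulr_le0_ge0 // ltW.
  apply: (@le_trans _ _ (P * (M * lam (z 0%N)))); first by rewrite ler_pM2l.
  by rewrite mulrCA ler_pM2l.
have zi1 : ~ Xinf (z i.+1).
  move=> zi1; have := hinf i lin zi zi1.
  rewrite ler_pdivrMr // => /le_trans/(_ tP).
  by rewrite leNgt gtr_pMl ?tM2.
have li10 : 0 < lam (z i.+1) by exact: lam0.
have step : D (z i) (z i.+1) <= t * M ^+ 2 * L * lam (z i.+1).
  have := hfin i lin zi zi1; rewrite ler_pdivrMr ?mulr_gt0 // mulrA => /le_trans; apply.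
  by rewrite ler_pM2r.
have Di : D (z i) (z i.+1) <= e * (L * lam (z 0%N)).
  have hl1 := hlam _ _ zi1 zi.
  (* Applying [hlam] to [lam (z i.+1)] brings the step itself back on the right. If it is the larger
     term, [tM3] forces it to be at most [0]; otherwise [hl] supplies the last factor [M], and
     [t * M ^+ 4 = e ^+ 3 <= e]. *)
  have : D (z i) (z i.+1) <= t * M ^+ 3 * Num.max (D (z i) (z i.+1)) (L * lam (z i)).
    apply: le_trans step _; rewrite (Dsym (z i)) //.
    have -> : t * M ^+ 2 * L * lam (z i.+1) = t * M ^+ 2 * (L * lam (z i.+1)) by ring.
    by rewrite exprSr -!mulrA !ler_pM2l ?exprn_gt0.
  have [hm|hm] := leP (D (z i) (z i.+1)) (L * lam (z i)).
    move=> /le_trans; apply.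
    apply: (@le_trans _ _ (t * M ^+ 3 * (L * (M * lam (z 0%N))))).
      by rewrite ler_pM2l ?mulr_gt0 ?exprn_gt0 // ler_pM2l.
    have -> : t * M ^+ 3 * (L * (M * lam (z 0%N))) = t * M ^+ 4 * (L * lam (z 0%N)) by ring.
    rewrite ler_pM2r ?mulr_gt0 // -he ler_iXnr // ltW //.
  move=> h; have D00 : D (z i) (z i.+1) <= 0.
    by rewrite leNgt; apply/negP => Dp; move: h; rewrite leNgt gtr_pMl // tM3.
  by apply: le_trans D00 _; rewrite !mulr_ge0 // ltW.
have hz1 j : (j <= i.+1)%N -> ~ Xinf (z j).
  by rewrite leq_eqVlt => /predU1P[->//|]; exact: hz.
have hs1 j : (j < i.+1)%N -> D (z j) (z j.+1) <= e * (L * lam (z 0%N)).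
  by rewrite ltnS leq_eqVlt => /predU1P[->//|]; exact: hs.
by split=> //; split=> //; exact: bound.
Qed.

(** * Values, symmetry and positivity of [dlambda] *)

Lemma dlambda_fin (R : realType) (X : Type) (K : R) (Xinf : set X)
    (d : X -> X -> \bar R) (hd : quasi_metric K Xinf d)
    (lambda : X -> \bar R) (L : R) (x y : X) (a b : R) :
  ~ Xinf x -> ~ Xinf y -> lambda x = a%:E -> lambda y = b%:E ->
  0 < a -> 0 < b ->
  dlambda Xinf d lambda L x y = (fine (d x y) / (a * b))%:E.
Proof.
move=> hx hy lx ly a0 b0; rewrite /dlambda lx ly !eqe !gt_eqF //=.
rewrite !memNset //= -(quasi_metric_fineK hd) //= -EFinM inver.
by rewrite gt_eqF ?mulr_gt0 // -EFinM.
Qed.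

Lemma dlambda_infr (R : realType) (X : Type) (Xinf : set X)
    (d : X -> X -> \bar R) (lambda : X -> \bar R) (L : R) (x y : X) (a : R) :
  ~ Xinf x -> Xinf y -> lambda x = a%:E -> lambda y = +oo%E -> 0 < a ->
  dlambda Xinf d lambda L x y = (L / a)%:E.
Proof.
move=> hx hy lx ly a0; rewrite /dlambda lx ly eqe (gt_eqF a0) (_ : (+oo%E == 0%E :> \bar R) = false) //=.
by rewrite memNset // mem_set //= inver gt_eqF // -EFinM.
Qed.

Lemma dlambda_sym (R : realType) (X : Type) (K : R) (Xinf : set X)
    (d : X -> X -> \bar R) (hd : quasi_metric K Xinf d)
    (lambda : X -> \bar R) (L : R) (x y : X) :
  dlambda Xinf d lambda L x y = dlambda Xinf d lambda L y x.
Proof.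
rewrite /dlambda orbC andbC; case: ifP => // _.
case: (boolP (x \in Xinf)) => hx; case: (boolP (y \in Xinf)) => hy //=.
rewrite (qm_sym hd) ?[(lambda x * _)%E]muleC // => -[/mem_set].
by rewrite (negbTE hx).
Qed.

Lemma dlambdaxx (R : realType) (X : Type) (K : R) (Xinf : set X)
    (d : X -> X -> \bar R) (hd : quasi_metric K Xinf d)
    (lambda : X -> \bar R) (L : R) (x : X) :
  lambda x != 0%E -> dlambda Xinf d lambda L x x = 0%E.
Proof.
move=> /negbTE lx; rewrite /dlambda lx /=.
case: (boolP (x \in Xinf)) => //= hx.
rewrite (qm_eq0 hd _).2 ?mul0e // => -[/mem_set].
by rewrite (negbTE hx).
Qed.

(** Since [Xinf] has at most one point, one of the two distinct points lies outside it, by symmetry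
    the first; [dlambda] is then a quotient of positive reals. *)
Lemma dlambda_gt0 (R : realType) (X : Type) (K : R) (Xinf : set X)
    (d : X -> X -> \bar R) (hd : quasi_metric K Xinf d) (hXinf1 : is_subset1 Xinf)
    (lambda : X -> \bar R) (hlambda0 : forall x, (0 <= lambda x)%E)
    (hXinf : Xinf = lambda @^-1` [set +oo%E]) (L : R) (hL : 0 < L) (x y : X) :
  lambda x != 0%E -> lambda y != 0%E -> x <> y ->
  (0 < dlambda Xinf d lambda L x y)%E.
Proof.
have fin u : lambda u != 0%E -> ~ Xinf u ->
    exists2 a : R, 0 < a & lambda u = a%:E.
  move=> u0 hu; have : (0 < lambda u)%E by rewrite lt0e u0 hlambda0.
  move: hu; rewrite hXinf /=; case: (lambda u) => [a _| |]//.
  by rewrite lte_fin => a0; exists a.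
have lt u v : lambda u != 0%E -> lambda v != 0%E -> ~ Xinf u -> u <> v ->
    (0 < dlambda Xinf d lambda L u v)%E.
  move=> u0 v0 hu uv; have [a a0 la] := fin u u0 hu.
  case: (pselect (Xinf v)) => hv.
    rewrite (dlambda_infr _ _ hu hv la) ?lte_fin ?divr_gt0 //.
    by move: hv; rewrite hXinf.
  have [b b0 lb] := fin v v0 hv.
  rewrite (dlambda_fin hd _ hu hv la lb) // lte_fin divr_gt0 ?mulr_gt0 //.
  exact: quasi_metric_fine_gt0 hd _ _ hu hv uv.
move=> x0 y0 xy; case: (pselect (Xinf x)) => hx; last exact: lt.
rewrite (dlambda_sym hd); apply: lt => // [hy|/esym//].
by apply: xy; exact: hXinf1.
Qed.

(** * Transfer of chains from [dlambda] to [d] *)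

(** The orientation [lambda (z 0) <= lambda (z n)] keeps [z 0] out of [Xinf], yields the bound [hP],
    and at the end gives [lam (z 0) ^ 2 <= lam (z 0) * lam (z n)]. *)
Lemma dlambda_chain_oriented (R : realType) (X : Type) (K : R) (Xinf : set X)
    (d : X -> X -> \bar R) (hd : quasi_metric K Xinf d) (hXinf1 : is_subset1 Xinf)
    (lambda : X -> \bar R) (hlambda0 : forall x, (0 <= lambda x)%E)
    (L M : R) (hL : 0 < L) (hM : 1 <= M)
    (hXinf : Xinf = lambda @^-1` [set +oo%E])
    (hd_lambda : forall x y, dist_dom Xinf x y ->
       (d x y <= M%:E * maxe (L%:E * lambda x) (L%:E * lambda y))%E)
    (hlambda_d : forall x y, dist_dom Xinf x y ->
       (L%:E * lambda x <= M%:E * maxe (d x y) (L%:E * lambda y))%E)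
    (t e : R) (t0 : 0 < t) (e01 : 0 < e < 1) (he : e ^+ 3 = t * M ^+ 4)
    (n : nat) (z : nat -> X) :
  z 0%N <> z n -> (lambda (z 0%N) <= lambda (z n))%E ->
  (forall i, (i <= n)%N -> lambda (z i) != 0%E) ->
  (forall i, (i < n)%N -> (dlambda Xinf d lambda L (z i) (z i.+1) <=
     t%:E * dlambda Xinf d lambda L (z 0%N) (z n))%E) ->
  has_chain Xinf d e.
Proof.
move=> z0n l0n hz hs; apply: contrapT => hno.
have M0 : 0 < M by exact: lt_le_trans hM.
have infE x : Xinf x -> lambda x = +oo%E by rewrite hXinf.
pose lam x := fine (lambda x).
have lamE x : ~ Xinf x -> lambda x = (lam x)%:E.
  move=> hx; rewrite fineK // ge0_fin_numE // ltey.
  by apply/eqP => lx; apply: hx; rewrite hXinf.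
have lam_gt0 x : ~ Xinf x -> lambda x != 0%E -> 0 < lam x.
  move=> hx; rewrite lamE // eqe lt0r => -> /=.
  by rewrite -lee_fin -lamE.
have z0 : ~ Xinf (z 0%N).
  move=> hz0; apply: z0n; apply: hXinf1 => //; rewrite hXinf /=.
  by apply/eqP; rewrite -leye_eq -(infE _ hz0).
pose D x y := fine (d x y).
have DE x y : ~ Xinf x -> ~ Xinf y -> d x y = (D x y)%:E.
  by move=> hx hy; rewrite (quasi_metric_fineK hd).
have hdl x y : ~ Xinf x -> ~ Xinf y ->
    D x y <= M * Num.max (L * lam x) (L * lam y).
  move=> hx hy; have /hd_lambda : dist_dom Xinf x y by case.
  by rewrite DE // !lamE // -!EFinM -EFin_max -EFinM lee_fin.
have hld x y : ~ Xinf x -> ~ Xinf y ->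
    L * lam x <= M * Num.max (D x y) (L * lam y).
  move=> hx hy; have /hlambda_d : dist_dom Xinf x y by case.
  by rewrite DE // !lamE // -!EFinM -EFin_max -EFinM lee_fin.
have l0 : 0 < lam (z 0%N) by apply: lam_gt0 => //; exact: hz.
(* The first branch can be discarded only once [bounds] is available. *)
pose P := if pselect (Xinf (z n)) then L / lam (z 0%N)
          else D (z 0%N) (z n) / (lam (z 0%N) * lam (z n)).
have PE : dlambda Xinf d lambda L (z 0%N) (z n) = P%:E.
  rewrite /P; case: pselect => hn.
    by apply: dlambda_infr => //; [exact: lamE | exact: infE].
  apply: (dlambda_fin hd) => //; [exact: lamE | exact: lamE |].
  by apply: lam_gt0 => //; exact: hz.
have hP : P * lam (z 0%N) <= M * L.
  rewrite /P; case: pselect => hn; first by rewrite divfK ?gt_eqF // ler_peMl // ltW.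
  have ln : 0 < lam (z n) by apply: lam_gt0 => //; exact: hz.
  rewrite invfM -mulrA [_^-1 * _ * _]mulrAC mulVf ?gt_eqF // mul1r.
  rewrite ler_pdivrMr // -mulrA.
  apply: le_trans (hdl _ _ z0 hn) _; rewrite ler_pM2l // ge_max lexx andbT.
  by rewrite ler_pM2l // -lee_fin -!lamE.
have hinf i : (i < n)%N -> ~ Xinf (z i) -> Xinf (z i.+1) ->
    L / lam (z i) <= t * P.
  move=> lin hi hi1; rewrite -lee_fin [in leRHS]EFinM -PE; apply: le_trans (hs _ lin).
  rewrite (dlambda_infr d L hi hi1 (lamE _ hi) (infE _ hi1)) //.
  by apply: lam_gt0 => //; exact/hz/ltnW.
have hfin i : (i < n)%N -> ~ Xinf (z i) -> ~ Xinf (z i.+1) ->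
    D (z i) (z i.+1) / (lam (z i) * lam (z i.+1)) <= t * P.
  move=> lin hi hi1; rewrite -lee_fin [in leRHS]EFinM -PE; apply: le_trans (hs _ lin).
  rewrite (dlambda_fin hd L hi hi1 (lamE _ hi) (lamE _ hi1)) //.
    by apply: lam_gt0 => //; exact/hz/ltnW.
  by apply: lam_gt0 => //; exact: hz.
have hch := no_chain_bound hd e01 hno.
have Dsym x y : ~ Xinf x -> ~ Xinf y -> D x y = D y x.
  by move=> hx hy; rewrite /D (qm_sym hd) // => -[].
have bounds := inversion_chain_bounds hL hM t0 e01 he hch Dsym
  (fun i lin hi => lam_gt0 _ hi (hz i lin)) hld z0 hP hinf hfin.
have zn : ~ Xinf (z n) by have [] := bounds n (leqnn n).
have ln : 0 < lam (z n) by apply: lam_gt0 => //; exact: hz.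
have l0n' : lam (z 0%N) <= lam (z n) by rewrite -lee_fin -!lamE.
have D0 : 0 < D (z 0%N) (z n) by exact: quasi_metric_fine_gt0 hd _ _ z0 zn z0n.
move: (e01) => /andP[e0 e1].
apply: hno; apply: (has_chain_of_steps hd e1 (n := n) (w := z)) => // i lin.
  by have [] := bounds i lin.
have [hi li] := bounds i (ltnW lin); have [hi1 li1] := bounds i.+1 lin.
have li0 : 0 < lam (z i) by apply: lam_gt0 => //; exact/hz/ltnW.
have li10 : 0 < lam (z i.+1) by apply: lam_gt0 => //; exact: hz.
have := hfin i lin hi hi1; rewrite ler_pdivrMr ?mulr_gt0 // => /le_trans; apply.
have -> : P = D (z 0%N) (z n) / (lam (z 0%N) * lam (z n)).
  by rewrite /P; case: pselect.
(* This turns the step bound into [t * M ^+ 2 * D (z 0) (z n)], and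
   [t * M ^+ 2 <= t * M ^+ 4 = e ^+ 3 <= e]. *)
have : lam (z i) * lam (z i.+1) <= M ^+ 2 * (lam (z 0%N) * lam (z n)).
  apply: (@le_trans _ _ ((M * lam (z 0%N)) * (M * lam (z 0%N)))).
    by rewrite ler_pM // ltW.
  have -> : M * lam (z 0%N) * (M * lam (z 0%N)) =
    M ^+ 2 * (lam (z 0%N) * lam (z 0%N)) by ring.
  by rewrite ler_pM2l ?exprn_gt0 // ler_pM2l.
rewrite -ler_pdivrMr ?mulr_gt0 // => hll.
have -> : t * (D (z 0%N) (z n) / (lam (z 0%N) * lam (z n))) *
    (lam (z i) * lam (z i.+1)) = D (z 0%N) (z n) *
    (t * (lam (z i) * lam (z i.+1) / (lam (z 0%N) * lam (z n)))).
  by field; rewrite !gt_eqF.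
rewrite [e * _]mulrC ler_pM2l //.
apply: (@le_trans _ _ (e ^+ 3)); last by rewrite ler_iXnr // ltW.
rewrite he ler_pM2l //; apply: le_trans hll _; exact: ler_weXn2l.
Qed.

Theorem proposition6 (R : realType) (X : Type) (K : R) (Xinf : set X)
    (d : X -> X -> \bar R) (hd : quasi_metric K Xinf d)
    (infty : X) (hinfty : Xinf infty)
    (* infty is the only infinitely remote point *)
    (hXinf1 : is_subset1 Xinf)
    (lambda : X -> \bar R) (hlambda0 : forall x, (0 <= lambda x)%E)
    (L K' : R) (hL : 0 < L) (hK' : K <= K')
    (hXinf : Xinf = lambda @^-1` [set +oo%E])
    (hd_lambda : forall x y, dist_dom Xinf x y ->
       (d x y <= K'%:E * maxe (L%:E * lambda x) (L%:E * lambda y))%E)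
    (hlambda_d : forall x y, dist_dom Xinf x y ->
       (L%:E * lambda x <= K'%:E * maxe (d x y) (L%:E * lambda y))%E)
    (theta : R) (htheta1 : theta < 1) (htheta : theta <= 1 / K ^+ 19)
    (* the parameter of the chain in (X, d) has to be smaller than 1 as well *)
    (htheta' : (theta * K' ^+ 4) `^ (3%:R^-1) < 1) :
  has_chain (lambda @^-1` [set 0%E]) (dlambda Xinf d lambda L) theta ->
  has_chain Xinf d ((theta * K' ^+ 4) `^ (3%:R^-1)).
Proof.
case=> n [z [hz' [i [j [k [[iln jln kln] [zij zik zjk]]]]] hs]].
have hz a : (a <= n)%N -> lambda (z a) != 0%E.
  by move=> /hz' h; apply/eqP => h0; exact: h.
(* A nonpositive bound on the steps makes consecutive points equal, so the chain would be constant.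
   This yields both [z 0 <> z n] and [0 < theta]. *)
have not_const : (dlambda Xinf d lambda L (z 0%N) (z n) * theta%:E <= 0)%E -> False.
  move=> tP; suff h a : (a <= n)%N -> z a = z 0%N.
    by apply: zij; rewrite !h.
  elim: a => // a IH lan; rewrite -IH ?(ltnW lan) //; apply: contrapT => za.
  have := le_trans (hs a lan); rewrite muleC => /(_ _ tP); apply/negP; rewrite -ltNge.
  apply: (dlambda_gt0 hd) => //; [exact/hz/ltnW | exact: hz | by move=> /esym].
have z0n : z 0%N <> z n.
  move=> h; apply: not_const.
  by rewrite -h (dlambdaxx hd) ?mul0e ?lexx //; exact: hz.
have t0 : 0 < theta.
  rewrite ltNge; apply/negP => t0; apply: not_const.
  rewrite mule_ge0_le0 ?lee_fin //; apply/ltW/(dlambda_gt0 hd) => //; exact: hz.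
(* At most one of the three distinct points is [infty], which leaves two distinct points at finite
   distance. *)
have K1 : 1 <= K.
  have two x y : Xinf x -> x <> y -> ~ Xinf y.
    by move=> hx xy hy; apply: xy; exact: hXinf1.
  case: (pselect (Xinf (z i))) => hi.
    exact: quasi_metric_ge1 hd (z j) (z k) (two _ _ hi zij) (two _ _ hi zik) zjk.
  case: (pselect (Xinf (z j))) => hj.
    exact: quasi_metric_ge1 hd (z i) (z k) hi (two _ _ hj zjk) zik.
  exact: quasi_metric_ge1 hd (z i) (z j) hi hj zij.
have M1 : 1 <= K' by exact: le_trans hK'.
have tM0 : 0 < theta * K' ^+ 4.
  by rewrite mulr_gt0 // exprn_gt0 // (lt_le_trans ltr01).
have e01 : 0 < (theta * K' ^+ 4) `^ (3%:R^-1) < 1 by rewrite powR_gt0.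
have he : ((theta * K' ^+ 4) `^ (3%:R^-1)) ^+ 3 = theta * K' ^+ 4.
  by rewrite -powR_mulrn ?powR_ge0 // -powRrM mulVf ?pnatr_eq0 // powRr1 // ltW.
case/orP: (le_total (lambda (z 0%N)) (lambda (z n))) => l0n.
  exact: (dlambda_chain_oriented hd hXinf1 hlambda0 hL M1 hXinf hd_lambda hlambda_d
    t0 e01 he z0n l0n).
(* Step [a] of the reversed chain is step [n - a.+1] of [z], traversed backwards. *)
apply: (dlambda_chain_oriented hd hXinf1 hlambda0 hL M1 hXinf hd_lambda hlambda_d
  t0 e01 he (n := n) (z := fun a => z (n - a)%N)); rewrite ?subnn ?subn0 //.
- by move=> /esym.
- by move=> a _; apply: hz; exact: leq_subr.
move=> a lan; rewrite (dlambda_sym hd) [in leRHS](dlambda_sym hd).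
rewrite -(subnSK lan); apply: hs; rewrite subnSK //; exact: leq_subr.
Qed.
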